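(* Let $b>1$ and $x^*=\frac{1}{b-1}$, so that $x^*>0$. Consider the functional equation $y(x+1)=y(bx)$. (i) If $x_0>x^*$, then for every function $y_0:[x_0+1,\,bx_0)\to\mathbb{R}$ the initial value problem for the functional equation with initial condition $y(x)=y_0(x)$ for $x\in[x_0+1,\,bx_0)$ has a unique solution on $(bx^*,\infty)$. (ii) If $x_0<x^*$, then for every function $y_0:[bx_0,\,x_0+1)\to\mathbb{R}$ the initial value problem for the functional equation with initial condition $y(x)=y_0(x)$ for $x\in[bx_0,\,x_0+1)$ has a unique solution on $(-\infty,bx^* )$. (iii) Let $\alpha>x^*$ and $\beta<x^*$. For all functions $f_1:[b\beta,\,\beta+1)\to\mathbb{R}$ and $f_2:[\alpha+1,\,b\alpha)\to\mathbb{R}$, the initial value problem for the functional equation with initial conditions $y=f_1$ on $[b\beta,\,\beta+1)$ and $y=f_2$ on $[\alpha+1,\,b\alpha)$ has a unique solution on $\mathbb{R}\setminus\{bx^*\}$.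
   Context: A solution of the initial value problem on a set $J\subseteq\mathbb{R}$ is a function $y:J\to\mathbb{R}$ that satisfies $y(x+1)=y(bx)$ for all real $x$ with $x+1\in J$ and $bx\in J$, and agrees with the prescribed initial functions on their domains. No continuity is assumed. The point $x^*=\frac1{b-1}$ is the solution of $x+1=bx$, so $bx^*=x^*+1$. *)

(* Defs.v *)
From mathcomp Require Import all_boot all_order all_algebra.
From mathcomp Require Import boolp classical_sets set_interval reals.

Set Implicit Arguments.
Unset Strict Implicit.
Unset Printing Implicit Defensive.

Import Order.TTheory GRing.Theory Num.Theory.
Local Open Scope classical_set_scope.
Local Open Scope ring_scope.

(* A set [J : set R] used as a type is the subtype [{x : R | x \in J}], so
   [J -> R] is the type of functions defined on [J] only. *)

Definition xstar (R : realType) (b : R) : R := 1 / (b - 1).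

Definition satisfies_feq (R : realType) (b : R) (J : set R) (y : J -> R) :
    Prop :=
  forall (x : R) (h1 : x + 1 \in J) (hb : b * x \in J),
    y (exist _ (x + 1) h1) = y (exist _ (b * x) hb).

(* In particular, the domain [I] of the initial function is contained in [J]. *)
Definition agrees_with (R : realType) (I J : set R) (y0 : I -> R)
    (y : J -> R) : Prop :=
  forall (x : R) (hI : x \in I),
    exists hJ : x \in J, y (exist _ x hJ) = y0 (exist _ x hI).

(* Main.v *)
(** In the coordinate [t - b x*] the map [x + 1 |-> b x] is multiplication by
    [b], so the equation says that [y] is constant on the orbits of the
    multiplicative group generated by [b]. The half-open intervals carrying the
    initial data meet every orbit in the corresponding half line exactly once,
    hence an initial function is the same thing as a solution. *)
Require Import Defs.
From mathcomp Require Import all_boot all_order all_algebra.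
From mathcomp Require Import boolp classical_sets set_interval reals.
From mathcomp Require Import ring lra.

Set Implicit Arguments.
Unset Strict Implicit.
Unset Printing Implicit Defensive.

Import Order.TTheory GRing.Theory Num.Theory.
Local Open Scope classical_set_scope.
Local Open Scope ring_scope.

(** * The constant [xstar b] and the powers of [b] *)

Lemma mul_xstar (R : realType) (b : R) : 1 < b -> b * xstar b = xstar b + 1.
Proof. by move=> b1; rewrite /xstar; field; lra. Qed.

(** A weak Bernoulli inequality, [n (b - 1) <= b ^ n], combined with the Archimedean property. *)
Lemma ltr_expn_unbounded (R : realType) (b v : R) :
  1 < b -> exists n, v < b ^+ n.
Proof.
move=> b1.
have bern n : n%:R * (b - 1) <= b ^+ n.
  elim: n => [|n IHn]; first by rewrite mul0r.
  have bn1 : 1 <= b ^+ n by rewrite exprn_ege1 // ltW.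
  by rewrite exprS -natr1; nra.
have [n] : exists n : nat, v / (b - 1) < n%:R.
  exists (Num.bound `|v / (b - 1)|).
  by apply: le_lt_trans (ler_norm _) (archi_boundP _).
rewrite ltr_pdivrMr; last by lra.
by move=> vn; exists n; apply: lt_le_trans vn (bern n).
Qed.

(** The exponent is found by minimality: for [1 <= v], the first power of [b] exceeding [v] is one
    step too large; for [v < 1], the first power lifting [v] to at least [1] cannot overshoot
    [b]. *)
Lemma exprz_mantissa (R : realType) (b v : R) : 1 < b -> 0 < v ->
  exists s, 1 <= s < b /\ exists k : int, v = s * b ^ k.
Proof.
move=> b1 v0; have b0 : 0 < b by lra.
have bn0 n : 0 < b ^+ n by rewrite exprn_gt0.
case: (lerP 1 v) => v1.
  have [[|n] vn nmin] := ex_minnP (ltr_expn_unbounded v b1).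
    by move: vn; rewrite expr0; lra.
  exists (v / b ^+ n); split.
    rewrite ler_pdivlMr // mul1r ltr_pdivrMr // -exprS vn andbT leNgt.
    by apply/negP => /nmin; rewrite ltnn.
  by exists (Posz n); rewrite -exprnP divfK // gt_eqF.
have ex : exists n, 1 <= v * b ^+ n.
  have [n vn] := ltr_expn_unbounded v^-1 b1.
  by exists n; rewrite mulrC -ler_pdivrMr // div1r ltW.
have [[|n] vn nmin] := ex_minnP ex.
  by move: vn; rewrite expr0; lra.
exists (v * b ^+ n.+1); split.
  rewrite vn /= exprS mulrCA gtr_pMr // ltNge.
  by apply/negP => /nmin; rewrite ltnn.
by exists (Negz n); rewrite NegzE -exprnN mulfK // gt_eqF.
Qed.

(** A positive exponent would push [s' * b ^ k] up to at least [b]; a negative one is reduced to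
    this case by exchanging [s] and [s']. *)
Lemma mantissa_inj (R : realType) (b s s' : R) (k : int) : 1 < b ->
  1 <= s < b -> 1 <= s' < b -> s = s' * b ^ k -> s = s'.
Proof.
move=> b1.
have key (u u' : R) n :
    1 <= u < b -> 1 <= u' < b -> u = u' * b ^+ n -> u = u'.
  case: n => [|n] hu hu'; first by rewrite expr0 mulr1.
  have bn1 : 1 <= b ^+ n by rewrite exprn_ege1 // ltW.
  case/andP: hu hu' => _ ub /andP[u'1 _] e; suff : b <= u by lra.
  by rewrite e exprS mulrCA ler_peMr ?mulr_ege1 //; lra.
have b0 : b != 0 by rewrite gt_eqF //; lra.
case: k => n hs hs'; first exact: key.
rewrite NegzE -exprnN => e; apply/esym/(key _ _ n.+1) => //.
by rewrite e divfK // expf_neq0.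
Qed.

(** * Orbits and fundamental domains *)

(** The centre [b * xstar b] is the fixed point of [t |-> b (t - 1)], the map that takes [x + 1] to
    [b x]. *)
Definition same_orbit (R : realType) (b t t' : R) : Prop :=
  exists k : int, t - b * xstar b = (t' - b * xstar b) * b ^ k.

Lemma same_orbit_refl (R : realType) (b t : R) : same_orbit b t t.
Proof. by exists 0; rewrite expr0z mulr1. Qed.

Lemma same_orbit_sym (R : realType) (b t t' : R) : 1 < b ->
  same_orbit b t t' -> same_orbit b t' t.
Proof.
move=> b1 [k e]; have b0 : b != 0 by rewrite gt_eqF //; lra.
by exists (- k); rewrite e -mulrA -expfzDr // subrr expr0z mulr1.
Qed.

Lemma same_orbit_trans (R : realType) (b t1 t2 t3 : R) : 1 < b ->
  same_orbit b t1 t2 -> same_orbit b t2 t3 -> same_orbit b t1 t3.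
Proof.
move=> b1 [k e] [l e']; have b0 : b != 0 by rewrite gt_eqF //; lra.
by exists (l + k); rewrite e e' -mulrA -expfzDr.
Qed.

Lemma same_orbit_step (R : realType) (b x : R) : 1 < b ->
  same_orbit b (b * x) (x + 1).
Proof.
by move=> b1; have e := mul_xstar b1; exists 1; rewrite expr1z e; lra.
Qed.

Record fundamental_domain (R : realType) (b : R) (J I : set R) : Prop := {
  fd_saturated : forall t t', same_orbit b t t' -> J t -> J t';
  fd_sub : I `<=` J;
  fd_meets : forall t, J t -> exists2 s, I s & same_orbit b t s;
  fd_inj : forall s s', I s -> I s' -> same_orbit b s s' -> s = s' }.

(** Through [m] the claim becomes existence and uniqueness of the mantissa. Since [k] may have
    either sign, [m] may be a multiple of [t - b * xstar b] or the inverse of one. *)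
Lemma fundamental_domain_coordinate (R : realType) (b : R) (m g : R -> R) :
  1 < b -> cancel m g -> cancel g m ->
  (forall t t', same_orbit b t t' <-> exists k : int, m t = m t' * b ^ k) ->
  fundamental_domain b [set t | 0 < m t] [set t | 1 <= m t < b].
Proof.
move=> b1 mK gK orbE; have b0 : 0 < b by lra.
split=> [t t' /(same_orbit_sym b1)/orbE[k] | t | t | s s'] /=.
- by move=> -> h; rewrite mulr_gt0 ?exprz_gt0.
- by case/andP => h _; apply: lt_le_trans h.
- case/(exprz_mantissa b1) => s [hs [k e]].
  exists (g s); first by rewrite /= gK.
  by apply/orbE; exists k; rewrite gK.
- move=> hs hs' /orbE[k] /(mantissa_inj b1 hs hs') e.
  exact: (can_inj mK).
Qed.

Lemma fundamental_domain_right (R : realType) (b x0 : R) :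
  1 < b -> xstar b < x0 ->
  fundamental_domain b `]b * xstar b, +oo[ `[x0 + 1, b * x0[.
Proof.
move=> b1 hx; have e := mul_xstar b1.
have a0 : 0 < x0 - xstar b by lra.
set c := b * xstar b in e *; set a := x0 - xstar b in a0.
have an0 : a != 0 by rewrite gt_eqF.
have ba : b * a = b * x0 - c by rewrite mulrBr.
have ea : a = x0 - xstar b by [].
(* As [c = xstar b + 1], this coordinate is [1] at [x0 + 1] and [b] at [b * x0]. *)
have fd : fundamental_domain b [set t | 0 < (t - c) / a]
                               [set t | 1 <= (t - c) / a < b].
  apply: (fundamental_domain_coordinate (g := fun v => v * a + c)) => //.
  - by move=> t; rewrite divfK // subrK.
  - by move=> v; rewrite addrK mulfK.
  - move=> t t'; split=> -[k h]; exists k; first by rewrite h mulrAC.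
    by apply: (mulIf (invr_neq0 an0)); rewrite h mulrAC.
congr fundamental_domain: fd; apply/seteqP; split => t /=; rewrite !in_itv /=
  ?andbT ?ler_pdivlMr ?ltr_pdivlMr ?ltr_pdivrMr //; lra.
Qed.

(* The interval is now closed at its endpoint farthest from [b x*], hence the
   coordinate is the inverse of a multiple of [t - b x*]. *)
Lemma fundamental_domain_left (R : realType) (b x0 : R) :
  1 < b -> x0 < xstar b ->
  fundamental_domain b `]-oo, b * xstar b[ `[b * x0, x0 + 1[.
Proof.
move=> b1 hx; have e := mul_xstar b1.
have d0 : b * (x0 - xstar b) < 0 by rewrite pmulr_rlt0; lra.
set c := b * xstar b in e *; set d := b * (x0 - xstar b) in d0.
have dn0 : d != 0 by rewrite lt_eqF.
have ed : d = b * x0 - c by rewrite /d mulrBr.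
have fd : fundamental_domain b [set t | 0 < d / (t - c)]
                               [set t | 1 <= d / (t - c) < b].
  apply: (fundamental_domain_coordinate (g := fun v => d / v + c)) => //.
  - by move=> t; rewrite invfM invrK mulrA divff // mul1r subrK.
  - by move=> v; rewrite addrK invfM invrK mulrA divff // mul1r.
  - move=> t t'; split=> -[k h]; exists (- k).
      by rewrite h invfM mulrA invr_expz.
    apply/invr_inj/(mulfI dn0).
    by rewrite h -/c invfM mulrA invr_expz opprK.
(* Cancelling the factor [b] turns the bound at the open end into one that is linear in [t]. *)
have ltd u : (b * u < d) = (u < x0 - xstar b) by rewrite /d ltr_pM2l //; lra.
have neg t : (0 < d / (t - c)) = (t < c).
  by rewrite nmulr_rgt0 // invr_lt0 subr_lt0.
congr fundamental_domain: fd; apply/seteqP; split => t /=;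
  rewrite !in_itv /= ?neg // => h.
- have tc : t - c < 0.
    by rewrite subr_lt0 -neg; case/andP: h => /(lt_le_trans ltr01).
  by move: h; rewrite ler_ndivlMr // ltr_ndivrMr // ltd; lra.
- have tc : t - c < 0 by lra.
  by rewrite ler_ndivlMr // ltr_ndivrMr // ltd; lra.
Qed.

(** Orbits do not leave the saturated set [J1], so none can meet both [I1] and [I2]. *)
Lemma fundamental_domainU (R : realType) (b : R) (J1 J2 I1 I2 : set R) :
  1 < b -> J1 `&` J2 = set0 ->
  fundamental_domain b J1 I1 -> fundamental_domain b J2 I2 ->
  fundamental_domain b (J1 `|` J2) (I1 `|` I2).
Proof.
move=> b1 J12 [sat1 sub1 meet1 inj1] [sat2 sub2 meet2 inj2].
have sep s s' : I1 s -> I2 s' -> ~ same_orbit b s s'.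
  move=> /sub1 h /sub2 h' o.
  by have : (J1 `&` J2) s' by [split => //; apply: sat1 h]; rewrite J12.
split=> [t t' o [h|h] | t [h|h] | t [h|h] | s s' [h|h] [h'|h'] o].
- by left; apply: sat1 h.
- by right; apply: sat2 h.
- by left; apply: sub1.
- by right; apply: sub2.
- by have [s hs o] := meet1 _ h; exists s => //; left.
- by have [s hs o] := meet2 _ h; exists s => //; right.
- exact: inj1.
- by case: (sep _ _ h h').
- by case: (sep _ _ h' h); apply: same_orbit_sym.
- exact: inj2.
Qed.

Lemma fundamental_domain_punctured (R : realType) (b alpha beta : R) :
  1 < b -> xstar b < alpha -> beta < xstar b ->
  fundamental_domain b [set~ b * xstar b]
    (`[b * beta, beta + 1[ `|` `[alpha + 1, b * alpha[).
Proof.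
move=> b1 ha hb.
have -> : [set~ b * xstar b] =
    `]-oo, b * xstar b[%classic `|` `]b * xstar b, +oo[%classic.
  apply/seteqP; split => t /=; rewrite !in_itv /= andbT.
    by move/eqP; rewrite neq_lt => /orP.
  by move/orP; rewrite -neq_lt => /eqP.
apply: fundamental_domainU => //; last 2 first.
- exact: fundamental_domain_left.
- exact: fundamental_domain_right.
- by apply/seteqP; split => t //= []; rewrite !in_itv /= andbT => h1 h2; lra.
Qed.

(** * Solutions as functions constant on orbits *)

(** The equation is chained along the orbit by induction on the exponent; saturation keeps each
    intermediate point in [J], where [y] is defined. Negative exponents exchange [p] and [q]. *)
Lemma feq_same_orbit (R : realType) (b : R) (J : set R) (y : J -> R) (p q : J) :
  1 < b -> (forall t t', same_orbit b t t' -> J t -> J t') ->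
  satisfies_feq b y -> same_orbit b (val p) (val q) -> y p = y q.
Proof.
move=> b1 sat feq; have b0 : b != 0 by rewrite gt_eqF //; lra.
set c := b * xstar b.
have pow n : forall u v : J, val u - c = (val v - c) * b ^+ n -> y u = y v.
  elim: n => [|n IHn] u v e.
    by congr y; apply/val_inj/(addIr (- c)); rewrite e expr0 mulr1.
  (* Chosen so that [x + 1] is the [n]-th point of the orbit after [v] and [b * x] is the next one,
     [u]. *)
  pose x := c + (val v - c) * b ^+ n - 1.
  have o : same_orbit b (val v) (x + 1).
    by apply: same_orbit_sym => //; exists n; rewrite -/c /x subrK addrC addKr.
  have h1 : x + 1 \in J by apply/mem_set/(sat _ _ o)/set_mem/(valP v).
  have ebx : b * x = val u.
    apply: (addIr (- c)); rewrite e exprS /x /c (mul_xstar b1).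
    by have := mul_xstar b1; lra.
  have h2 : b * x \in J by rewrite ebx; apply: valP u.
  rewrite -(IHn (exist _ (x + 1) h1) v); last first.
    by rewrite /= /x subrK addrC addKr.
  by rewrite (feq x h1 h2); congr y; apply: val_inj.
case=> -[n|n]; rewrite -/c; first exact: pow.
rewrite NegzE -exprnN => e; apply/esym/(pow n.+1).
by rewrite e divfK // expf_neq0.
Qed.

(** The solution is [f \o r], where [r] sends a point to the representative of its orbit in [I]. Any
    other solution is constant on orbits, so its value at [p] is the one prescribed at [r p]. *)
Lemma feq_unique_solution (R : realType) (b : R) (J I : set R) (f : I -> R) :
  1 < b -> fundamental_domain b J I ->
  exists! y : J -> R, satisfies_feq b y /\ agrees_with f y.
Proof.
move=> b1 [sat sub meet inj].
have /choice[r rP] (p : J) : exists q : I, same_orbit b (val p) (val q).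
  have [s /mem_set hs o] := meet _ (set_mem (valP p)).
  by exists (exist _ s hs).
have r_eq (p : J) (q : I) : same_orbit b (val p) (val q) -> r p = q.
  move=> o; apply/val_inj/inj; [exact/set_mem/valP.. |].
  exact: same_orbit_trans b1 (same_orbit_sym b1 (rP p)) o.
exists (f \o r); split; first split.
- move=> x h1 h2 /=; congr f; apply/esym/r_eq => /=.
  exact: same_orbit_trans b1 (same_orbit_step x b1) (rP (exist _ (x + 1) h1)).
- move=> x hI; exists (mem_set (sub x (set_mem hI))) => /=.
  by congr f; apply/r_eq/same_orbit_refl.
- move=> y [feq agr]; apply/funext => p /=.
  case: (r p) (rP p) => s hs o; have [hJ <-] := agr s hs.
  exact/esym/(feq_same_orbit b1 sat).
Qed.

(* Every point of the union lies in [I1] or in [I2], so the value [0] is never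
   taken by default. *)
Definition glue (R : realType) (I1 I2 : set R) (f1 : I1 -> R) (f2 : I2 -> R)
    (p : (I1 `|` I2)) : R :=
  if insub (val p) is Some q then f1 q
  else if insub (val p) is Some q then f2 q else 0.

(** Merges two initial conditions into one, so that the two-sided problem falls under
    [feq_unique_solution]. Disjointness ensures that the priority [glue] gives to [f1] never
    overrides [f2]. *)
Lemma agrees_with_glue (R : realType) (I1 I2 J : set R)
    (f1 : I1 -> R) (f2 : I2 -> R) (y : J -> R) : I1 `&` I2 = set0 ->
  agrees_with (glue f1 f2) y <-> agrees_with f1 y /\ agrees_with f2 y.
Proof.
move=> I12.
have glue1 x (h : x \in I1 `|` I2) (h1 : x \in I1) :
    glue f1 f2 (exist _ x h) = f1 (exist _ x h1).
  by rewrite /glue /= insubT.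
have glue2 x (h : x \in I1 `|` I2) (h2 : x \in I2) :
    glue f1 f2 (exist _ x h) = f2 (exist _ x h2).
  rewrite /glue /= insubF ?insubT //; apply/negbTE/negP => /set_mem h1.
  have : (I1 `&` I2) x by split=> //; apply: set_mem.
  by rewrite I12.
split=> [agr | [agr1 agr2] x h].
  split=> x hx.
    have h : x \in I1 `|` I2 by rewrite in_setU hx.
    by have [hJ e] := agr x h; exists hJ; rewrite e (glue1 _ _ hx).
  have h : x \in I1 `|` I2 by rewrite in_setU hx orbT.
  by have [hJ e] := agr x h; exists hJ; rewrite e (glue2 _ _ hx).
have := h; rewrite in_setU => /orP[] hx.
  by have [hJ e] := agr1 x hx; exists hJ; rewrite e (glue1 _ _ hx).
by have [hJ e] := agr2 x hx; exists hJ; rewrite e (glue2 _ _ hx).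
Qed.

Theorem theorem2p9 (R : realType) (b : R) (hb : 1 < b) :
  [/\ 0 < xstar b,
      (forall x0 : R, xstar b < x0 ->
        forall y0 : `[x0 + 1, b * x0[%classic -> R,
        exists! y : `]b * xstar b, +oo[%classic -> R,
          satisfies_feq b y /\ agrees_with y0 y),
      (forall x0 : R, x0 < xstar b ->
        forall y0 : `[b * x0, x0 + 1[%classic -> R,
        exists! y : `]-oo, b * xstar b[%classic -> R,
          satisfies_feq b y /\ agrees_with y0 y) &
      (forall alpha beta : R, xstar b < alpha -> beta < xstar b ->
        forall (f1 : `[b * beta, beta + 1[%classic -> R)
               (f2 : `[alpha + 1, b * alpha[%classic -> R),
        exists! y : [set~ b * xstar b] -> R,
          [/\ satisfies_feq b y, agrees_with f1 y & agrees_with f2 y])].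
Proof.
split; first by rewrite divr_gt0 //; lra.
- move=> x0 hx y0; apply: feq_unique_solution => //.
  exact: fundamental_domain_right.
- move=> x0 hx y0; apply: feq_unique_solution => //.
  exact: fundamental_domain_left.
move=> alpha beta ha hbeta f1 f2.
have I12 : `[b * beta, beta + 1[%classic `&` `[alpha + 1, b * alpha[ = set0.
  by apply/seteqP; split => t //= []; rewrite !in_itv /= => h1 h2; lra.
have [y [[feq agr] uniq]] := feq_unique_solution (glue f1 f2) hb
  (fundamental_domain_punctured hb ha hbeta).
have [agr1 agr2] := (agrees_with_glue f1 f2 y I12).1 agr.
exists y; split=> // y' [feq' agr1' agr2']; apply: uniq; split=> //.
exact/agrees_with_glue.
Qed.
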